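(* Let $F$ be a field of characteristic zero and let $L=\bigoplus_{i=1}^s L_i$ be a finite-dimensional Leibniz algebra over $F$ that is a direct sum of ideals $L_i$, each of which is a simple Leibniz algebra. For each $i$ let $I_i$ be the ideal of $L_i$ generated by squares and write $L_i=G_i\dot{+}I_i$ as a vector space direct sum, where $G_i$ is a Lie subalgebra of $L_i$. Then any derivation $d$ of $L$ is a sum $d=\sum_{i=1}^s d_i$, where each $d_i$ is a derivation of $L_i$ (extended by zero to the other summands) of the form $d_i=R_{a_i}+\alpha_i+\triangle_i$ on $L_i$, with $a_i\in G_i$, linear maps $\alpha_i: I_i\to I_i$ and $\triangle_i: G_i\to I_i$ (extended to $L_i$ by $\alpha_i|_{G_i}=0$ and $\triangle_i|_{I_i}=0$) such that $\alpha_i([x,y])=[\alpha_i(x),y]$ for all $x,y\in L_i$, and either $\alpha_i=0$ or $\alpha_i(I_i)=I_i$.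
   Context: A (right) Leibniz algebra over a field $F$ is an $F$-vector space $L$ with a bilinear product $[\cdot,\cdot]$ satisfying $[x,[y,z]]=[[x,y],z]-[[x,z],y]$ for all $x,y,z\in L$. Ideals are two-sided. For a Leibniz algebra $L$, $I$ denotes the ideal of $L$ generated by the squares $[x,x]$, $x\in L$; it coincides with the linear span of the squares, $[L,I]=0$, and $L/I$ is a Lie algebra. $L$ is called simple if its only ideals are $\{0\}$, $I$, $L$ and $[L,L]\neq I$. By the Levi-type theorem for Leibniz algebras (Barnes), a finite-dimensional simple Leibniz algebra in characteristic zero has a decomposition $L=G\dot{+}I$ with $G$ a (simple) Lie subalgebra. A derivation of $L$ is a linear map $d:L\to L$ with $d([x,y])=[d(x),y]+[x,d(y)]$ for all $x,y\in L$. For $a\in L$, $R_a:L\to L$ is the right multiplication operator $R_a(x)=[x,a]$. *)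

(* Defs.v *)
From HB Require Import structures.
From mathcomp Require Import all_boot all_order all_algebra.

Set Implicit Arguments.
Unset Strict Implicit.
Unset Printing Implicit Defensive.

Import GRing.Theory.
Local Open Scope ring_scope.

(* An algebra structure on the vector space L is given by its product           *)
(* br : {bilinear L -> L -> L}.  The notions below are relative to a subspace U *)
(* of L; they are those of the algebra U as soon as U is closed under br, and   *)
(* those of L itself for U = {:L}.                                              *)
Section Leibniz.

Context {F : fieldType} {L : vectType F}.
Variable br : {bilinear L -> L -> L}.
Implicit Types (U V W I J K G : {vspace L}) (d : 'End(L)).

Definition right_leibniz : Prop :=
  forall x y z : L, br x (br y z) = br (br x y) z - br (br x z) y.

Definition subalgebra U : Prop := {in U &, forall x y, br x y \in U}.

Definition ideal_of U J : Prop :=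
  (J <= U)%VS /\
  forall x u, x \in J -> u \in U -> br x u \in J /\ br u x \in J.

(* J is the ideal of U generated by the squares of elements of U.               *)
Definition squares_ideal U J : Prop :=
  [/\ ideal_of U J,
      forall x, x \in U -> br x x \in J
    & forall K, ideal_of U K -> (forall x, x \in U -> br x x \in K) ->
        (J <= K)%VS].

(* [U, V], the span of the products; only products of basis vectors are listed, *)
(* as in the definition of prodv for falgType, which brvP shows to be enough.   *)
Definition brv U V : {vspace L} :=
  <<[seq br x y | x <- vbasis U, y <- vbasis V]>>%VS.

Lemma brvP U V W :
  reflect (forall x y, x \in U -> y \in V -> br x y \in W) (brv U V <= W)%VS.
Proof.
apply: (iffP idP) => [sUVW x y Ux Vy | sW].
  apply: (subvP sUVW).
  rewrite (coord_vbasis Ux) (coord_vbasis Vy) linear_sumlz memv_suml // => i _.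
  rewrite linear_sumr memv_suml // => j _.
  rewrite linearZl_LR linearZr_LR !memvZ //.
  by apply: memv_span; apply: allpairs_f; rewrite memt_nth.
apply/span_subvP => _ /allpairsP[[x y] /= [Ux Vy ->]].
by apply: sW; apply: vbasis_mem.
Qed.

Definition leibniz_simple U : Prop :=
  exists I,
    [/\ squares_ideal U I,
        forall J, ideal_of U J -> [\/ J = 0%VS, J = I | J = U]
      & brv U U <> I].

Definition lie_subalgebra G : Prop :=
  [/\ subalgebra G,
      {in G, forall x, br x x = 0}
    & {in G & &, forall x y z,
        br x (br y z) + br y (br z x) + br z (br x y) = 0}].

Definition derivation_of U d : Prop :=
  (d @: U <= U)%VS /\
  {in U &, forall x y, d (br x y) = br (d x) y + br x (d y)}.

End Leibniz.

(* Main.v *)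
(* Each L_i is perfect, so d preserves L_i; it also preserves I_i, and I_i is   *)
(* annihilated from the left by L.  The G_i-component of d on G_i is a          *)
(* derivation of the simple Lie algebra G_i, hence equal to R_a for some a.     *)
(* Then alpha = (d - R_a)|I_i commutes with right multiplications, so its image *)
(* is an ideal contained in I_i, and Delta is the I_i-component of d on G_i.    *)
(*   Inner derivations come from the nondegeneracy of the Killing form of G_i.  *)
(* If it vanished, consider the eigenvalues mu_i of an ad x over a splitting    *)
(* field.  A rational vector q orthogonal to all relations mu_i = mu_j and      *)
(* mu_i + mu_j = mu_k defines a derivation equal to q_i on the generalized      *)
(* eigenspace of mu_i; its trace against ad x is sum_i q_i mu_i, which is thus  *)
(* 0.  So the mu_i satisfy both the given relations and those orthogonal to     *)
(* them, that is, all relations, and vanish; every ad x is then nilpotent, and  *)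
(* Engel's theorem gives a nonzero center.                                      *)

Require Import Defs.
From HB Require Import structures.
From mathcomp Require Import all_boot all_order all_algebra.
From mathcomp Require Import fieldext ring.
From Stdlib Require Import Classical.

Set Implicit Arguments.
Unset Strict Implicit.
Unset Printing Implicit Defensive.

Import Order.TTheory GRing.Theory Num.Theory.
Local Open Scope ring_scope.

(** * Linear algebra over fields of characteristic zero *)

(** Projections onto the summands reduce the theorem to one simple ideal U = G + I, which d
    preserves by [derivation_stable]. There [simple_leibniz_derivation] does the work. As I is an
    ideal and G a subalgebra, projection to G along I is multiplicative, so it turns d into a
    derivation of G. By [simple_complement_ideals] and [complement_nonabelian], G is simple and
    nonabelian, so this derivation is R_a on G by [simple_lie_derivation_inner]. By
    [squares_annihilate] a right factor matters only through its G-component; hence d - R_a on I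
    commutes with right multiplications, and simplicity makes its image 0 or I.

    Innerness is proved in coordinates by [derivation_inner], which represents the linear form v ->
    tr(D ad v) through the Killing form. The form is nondegenerate by simplicity and
    [killing_nonzero], which combines Cartan's criterion ([ad_nilpotent_of_killing0], brought down
    from a splitting field by [ad_nilpotent]) with [engel]. *)

Lemma trigonalizable_of_split (K : fieldType) n (A : 'M[K]_n) (s : seq K) :
    \big[mulmx/1%:M]_(z <- s) (A - z%:M) = 0 ->
  exists2 P, P \in unitmx & exists2 T, is_trig_mx T & P *m A = T *m P.
Proof.
elim: n A => [|n IHn] A sA0.
  exists 1%:M; rewrite ?unitmx1 //.
  by exists A; rewrite ?mul1mx ?mulmx1 //; apply/is_trig_mxP => -[].
(* If no z in s were an eigenvalue, every factor A - z would be invertible, and so would the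
   vanishing product. *)
have [z vA] : exists z, eigenvalue A z.
  elim: (s) sA0 => [|z r IHr].
    by rewrite big_nil => /eqP; rewrite oner_eq0.
  rewrite big_cons => sA0; have [zA|/negPn] := boolP (eigenvalue A z).
    by exists z.
  rewrite /eigenspace kermx_eq0 row_free_unit => uA; apply: IHr.
  by rewrite -[RHS](mulmx0 _ (invmx (A - z%:M))) -sA0 mulKmx.
have {vA} [v Av v0] := eigenvalueP vA.
have v1 : \rank v = 1%N by rewrite rank_rV v0.
(* e selects the first row of Q, which is made a multiple of the eigenvector v; the first row of Q A
   Q^-1 is then z e. *)
pose e : 'M[K]_(1, 1 + n) := row_mx 1%:M 0.
have [Q uQ eQA] : exists2 Q : 'M[K]_(1 + n), Q \in unitmx &
    e *m Q *m A = z *: (e *m Q).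
  exists (row_ebase v); first exact: row_ebase_unit.
  suff -> : e *m row_ebase v = invmx (col_ebase v) *m v.
    by rewrite -mulmxA Av -scalemxAr.
  apply: (canRL (mulKmx (col_ebase_unit v))).
  rewrite -[RHS]mulmx_ebase mulmxA v1; congr (_ *m _ *m _).
  by rewrite /e -pid_mx_row.
pose B : 'M[K]_(1 + n) := Q *m A *m invmx Q.
have QB : Q *m A = B *m Q by rewrite mulmxKV.
have BE : B = block_mx z%:M 0 (dlsubmx B) (drsubmx B).
  have : e *m B = z *: e by rewrite /B !mulmxA eQA -scalemxAl mulmxK.
  rewrite -{1}(submxK B) mul_row_block !mul0mx !addr0 !mul1mx.
  rewrite scale_row_mx scaler0 scalemx1 => /eq_row_mx[<- <-].
  by rewrite submxK.
move: B QB BE => B QB BE.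
pose B' := drsubmx B.
have prodB : \big[mulmx/1%:M]_(y <- s) (B - y%:M) = 0.
  suff: \big[mulmx/1%:M]_(y <- s) (B - y%:M) *m Q
        = Q *m \big[mulmx/1%:M]_(y <- s) (A - y%:M).
    by rewrite sA0 mulmx0 => /(canRL (mulmxK uQ)); rewrite mul0mx.
  elim: (s) => [|y r IHr]; first by rewrite !big_nil mulmx1 mul1mx.
  rewrite !big_cons -mulmxA IHr !mulmxA; congr (_ *m _).
  by rewrite mulmxBl mulmxBr QB mul_scalar_mx mul_mx_scalar.
have [|P uP [T trT PT]] := IHn B'.
  have [X [Y]] : exists X Y, \big[mulmx/1%:M]_(y <- s) (B - y%:M) =
      block_mx X 0 Y (\big[mulmx/1%:M]_(y <- s) (B' - y%:M)).
    elim: (s) => [|y r [X [Y IHr]]].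
      by exists 1%:M, 0; rewrite !big_nil -scalar_mx_block.
    rewrite !big_cons IHr BE (scalar_mx_block 1 n) opp_block_mx add_block_mx.
    rewrite mulmx_block !oppr0 !addr0 !(mulmx0, mul0mx) add0r !addr0 add0r.
    by do 2!eexists; reflexivity.
  rewrite prodB => /(congr1 (@drsubmx _ 1 n 1 n)); rewrite block_mxKdr => <-.
  by apply/matrixP => i j; rewrite !mxE.
pose P1 : 'M[K]_(1 + n) := block_mx 1%:M 0 0 P.
pose T1 : 'M[K]_(1 + n) := block_mx z%:M 0 (P *m dlsubmx B) T.
exists (P1 *m Q).
  have detP1 : \det P1 = \det P by rewrite (@det_lblock _ 1 n) det1 mul1r.
  by rewrite unitmx_mul uQ andbT unitmxE [\det _]detP1 -unitmxE.
exists T1.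
  rewrite [is_trig_mx _](@is_trig_block_mx _ 1 n 1 n) // eqxx trT andbT.
  exact: scalar_mx_is_trig.
have PB : P1 *m B = T1 *m P1.
  rewrite BE /P1 /T1 !mulmx_block !(mulmx0, mul0mx, mulmx1, mul1mx).
  by rewrite !(addr0, add0r) -PT.
by rewrite -mulmxA QB !mulmxA; congr (_ *m _).
Qed.

Lemma mxtrace_horner_trig (K : fieldType) n (T : 'M[K]_n.+1) p :
  is_trig_mx T -> \tr (horner_mx T p) = \sum_i p.[T i i].
Proof.
move=> /is_trig_mxP trT.
suff [_ H] : is_trig_mx (horner_mx T p) /\
             forall i, (horner_mx T p) i i = p.[T i i].
  by apply: eq_bigr => i _.
elim/poly_ind: p => [|p c [/is_trig_mxP tr_p IHp]].
  by rewrite rmorph0; split=> [|i]; rewrite ?mx0_is_trig // mxE horner0.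
rewrite rmorphD rmorphM /= horner_mx_X horner_mx_C.
split=> [|i].
  apply/is_trig_mxP => i j ij; rewrite !mxE big1 => [|k _].
    by rewrite -val_eqE /= ltn_eqF ?mulr0n ?addr0.
  have [ik|ki] := ltnP i k; first by rewrite tr_p ?mul0r.
  by rewrite trT ?mulr0 // (leq_ltn_trans ki).
rewrite hornerD hornerMX hornerC !mxE eqxx (bigD1 i) //= big1 ?addr0 ?IHp //.
move=> k nki; have [ik|ki] := ltnP i k; first by rewrite tr_p ?mul0r.
by rewrite [T k i]trT ?mulr0 // ltn_neqAle ki andbT.
Qed.

(** Denominators stay nonzero in K, so [ratr] respects sums and products of fractions without any
    order on K. *)
Lemma rat_rmorphism (K : fieldType) :
  [pchar K] =i pred0 -> exists f : {rmorphism rat -> K}, True.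
Proof.
move=> /pcharf0P charK0.
have nzZ (m : int) : m != 0 -> m%:~R != 0 :> K.
  by case: m => m; rewrite ?NegzE ?mulrNz ?oppr_eq0 -pmulrn charK0.
have nz x : (denq x)%:~R != 0 :> K by rewrite nzZ ?denq_neq0.
have ratrE (p q : int) : q != 0 -> ratr (p%:~R / q%:~R) = p%:~R / q%:~R :> K.
  move=> q0; have qQ0 : q%:~R != 0 :> rat by rewrite intr_eq0.
  set x : rat := _ / _; rewrite /ratr.
  apply/eqP; rewrite eqr_div ?nzZ ?denq_neq0 // -!intrM.
  suff -> : numq x * q = p * denq x by [].
  apply: (@intr_inj rat); rewrite !intrM numqE /x mulrAC divfK //.
have nzQ x : (denq x)%:~R != 0 :> rat by rewrite intr_eq0 denq_neq0.
have ratD : zmod_morphism (ratr : rat -> K).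
  move=> x y.
  have -> : x - y = (numq x * denq y - numq y * denq x)%:~R
                    / (denq x * denq y)%:~R.
    rewrite -{1}(divq_num_den x) -{1}(divq_num_den y) intrB !intrM.
    by field; rewrite !nzQ.
  rewrite ratrE ?mulf_neq0 ?denq_neq0 // /ratr intrB !intrM.
  by field; rewrite !nz.
have ratM : monoid_morphism (ratr : rat -> K).
  split=> [|x y]; first exact: (ratr_nat K 1).
  have -> : x * y = (numq x * numq y)%:~R / (denq x * denq y)%:~R.
    rewrite -{1}(divq_num_den x) -{1}(divq_num_den y) !intrM.
    by field; rewrite !nzQ.
  rewrite ratrE ?mulf_neq0 ?denq_neq0 // /ratr !intrM.
  by field; rewrite !nz.
pose f : GRing.RMorphism.type rat K := HB.pack (ratr : rat -> K)
  (GRing.isZmodMorphism.Build _ _ _ ratD)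
  (GRing.isMonoidMorphism.Build _ _ _ ratM).
by exists f.
Qed.

(* Over [rat] the row space of S and its orthogonal complement span everything, *)
(* so it is enough that mu satisfies the relations lying in either of the two.  *)
Lemma eq0_of_relations (K : fieldType) (f : {rmorphism rat -> K}) m n
    (S : 'M[rat]_(m, n)) (mu : 'cV[K]_n) :
    map_mx f S *m mu = 0 ->
    (forall q : 'rV_n, q *m S^T = 0 -> map_mx f q *m mu = 0) ->
  mu = 0.
Proof.
move=> Smu orthS; pose N := kermx S^T.
have Nmu : map_mx f N *m mu = 0.
  apply/row_matrixP => i; rewrite row_mul -map_row orthS ?row0 //.
  by rewrite -row_mul mulmx_ker row0.
have : row_full (col_mx S N).
  rewrite -cokermx_eq0; set C := cokermx _.
  have /esym : col_mx S N *m C = 0 by rewrite mulmx_coker.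
  rewrite mul_col_mx -col_mx0 => /eq_col_mx[/esym SC /esym NC].
  (* Columns of C are orthogonal to S, so C^T lies in N; but N C = 0. Hence C^T C = 0, and its
     diagonal entries are sums of rational squares. *)
  have /submxP[W CW] : (C^T <= N)%MS.
    by apply/sub_kermxP; rewrite -trmx_mul SC trmx0.
  have CC : C^T *m C = 0 by rewrite CW -mulmxA NC mulmx0.
  apply/eqP/matrixP => j i; rewrite [RHS]mxE; clearbody C.
  move/matrixP/(_ i i)/eqP: CC; rewrite !mxE psumr_eq0 => [|k _]; last first.
    by rewrite mxE -expr2 sqr_ge0.
  move=> /allP/(_ j (mem_index_enum j)); rewrite mxE -expr2 sqrf_eq0.
  by rewrite implyTb => /eqP CE; rewrite [LHS]CE.
case/row_fullP=> X XSN.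
rewrite -[mu]mul1mx -(map_mx1 f) -XSN map_mxM map_col_mx -mulmxA mul_col_mx.
by rewrite Smu Nmu col_mx0 mulmx0.
Qed.

(** Chinese remainder theorem for the pairwise coprime (X - z)^m. A Bezout relation supplies a
    correction that is invisible at the old nodes and right at the new one. *)
Lemma poly_interpolation (K : fieldType) m (phi : K -> K) (s : seq K) :
  uniq s -> exists g : {poly K},
    forall z, z \in s -> ('X - z%:P) ^+ m %| g - (phi z)%:P.
Proof.
elim: s => [|z s IHs] /=; first by exists 0.
case/andP=> zs /IHs[g gs].
have : coprimep (('X - z%:P) ^+ m) (\prod_(y <- s) ('X - y%:P) ^+ m).
  rewrite big_seq; apply: (big_ind (coprimep _)) => [|p q|y ys].
  - exact: coprimep1.
  - by rewrite coprimepMr => -> ->.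
  rewrite coprimep_expl // coprimep_expr // coprimep_XsubC root_XsubC.
  by apply: contraNneq zs => <-.
move=> /Bezout_eq1_coprimepP[[u v] /= uv1].
exists (g + ((phi z)%:P - g) * (v * \prod_(y <- s) ('X - y%:P) ^+ m)).
move=> y; rewrite inE; case: eqVneq => [-> _|_ /= ys].
  have -> : v * \prod_(y <- s) ('X - y%:P) ^+ m = 1 - u * ('X - z%:P) ^+ m.
    by apply: (canRL (addrK _)); rewrite addrC.
  set B := ('X - _) ^+ m.
  suff -> : g + ((phi z)%:P - g) * (1 - u * B) - (phi z)%:P
            = (g - (phi z)%:P) * u * B by rewrite dvdp_mull.
  by ring.
rewrite addrAC dvdp_add ?gs // mulrA dvdp_mull //.
by rewrite (big_rem y) //= dvdp_mulr.
Qed.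

Lemma irreducible_factor (F : fieldType) (p : {poly F}) :
  (1 < size p)%N -> exists2 r, r %| p & irreducible_poly r.
Proof.
have [k] := ubnP (size p); elim: k => // k IHk in p *.
rewrite ltnS => p_k p_gt1.
have p0 : p != 0 by rewrite -size_poly_gt0 ltnW.
(* Irreducibility over an arbitrary field need not be decidable, hence the excluded middle. *)
case: (classic (forall q : {poly F}, size q != 1%N -> q %| p -> q %= p)).
  by move=> irr_p; exists p; rewrite ?dvdpp.
move=> /not_all_ex_not Nirr; case: Nirr => q Nq.
have [q1 Nq'] := imply_to_and _ _ Nq.
have [q_p /negP neq_qp] := imply_to_and _ _ Nq'.
have q_k : (size q < k)%N.
  apply: leq_trans p_k; rewrite ltn_neqAle dvdp_leq // dvdp_size_eqp //.
  by rewrite neq_qp.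
have q_gt1 : (1 < size q)%N.
  by rewrite ltn_neqAle eq_sym q1 size_poly_gt0 (dvdpN0 q_p).
have [r r_q irr_r] := IHk q q_k q_gt1.
by exists r; rewrite // (dvdp_trans r_q).
Qed.

(** Adjoin a root x of an irreducible factor, divide by X - x, and repeat over the larger field. *)
Lemma split_field_exists (F : fieldType) (p : {poly F}) : p \is monic ->
  exists (E : fieldType) (f : {rmorphism F -> E}) (s : seq E),
    map_poly f p = \prod_(z <- s) ('X - z%:P).
Proof.
have [m] := ubnP (size p); elim: m => // m IHm in F p *.
rewrite ltnS => p_m mon_p.
have [p_le1|p_gt1] := leqP (size p) 1.
  exists F, idfun, [::]; rewrite big_nil map_poly_id //.
  by move/monicP: mon_p; rewrite (size1_polyC p_le1) lead_coefC => ->.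
have [r r_p irr_r] := irreducible_factor p_gt1.
have [E _ [x rx0 _]] := irredp_FAdjoin irr_r.
pose h : {rmorphism F -> E} := in_alg E.
have /factor_theorem[q Dp] : root (map_poly h p) x.
  move: rx0; rewrite !root_factor_theorem => /dvdp_trans; apply.
  by rewrite dvdp_map.
have mon_q : q \is monic.
  by rewrite -(monicMr _ (monicXsubC x)) -Dp map_monic.
have [|E' [f [s Dq]]] := IHm E q _ mon_q.
  apply: leq_trans p_m; rewrite -(size_map_poly h p) Dp.
  by rewrite size_Mmonic ?monic_neq0 ?monicXsubC // size_XsubC addn2.
exists E', (f \o h), (f x :: s).
rewrite map_poly_comp /= Dp rmorphM /= Dq big_cons mulrC.
by rewrite rmorphB /= map_polyX map_polyC.
Qed.

(** * Cartan's criterion and Engel's theorem *)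

Section Derivations.

Context {K : fieldType} {n : nat}.
Variable ad : {linear 'rV[K]_n.+1 -> 'M[K]_n.+1}.
Implicit Types (u v w : 'rV[K]_n.+1) (A D : 'M[K]_n.+1).

(** Here [u *m ad v] is the product [u, v] of an algebra on row vectors. Applied to u, the equation
    reads [u, vD] = [u, v]D - [uD, v]. *)
Definition ad_derivation D := forall v, ad (v *m D) = ad v *m D - D *m ad v.

(** Since A is a derivation, A - (a + b) sends [u, v] to [u(A - a), v] + [u, v(A - b)]; each term
    lowers i + j by one. *)
Lemma der_geigen A a b i j u v : ad_derivation A ->
  u *m (A - a%:M) ^+ i = 0 -> v *m (A - b%:M) ^+ j = 0 ->
  u *m ad v *m (A - (a + b)%:M) ^+ (i + j) = 0.
Proof.
move=> derA; have [k] := ubnP (i + j); elim: k => // k IHk in i j u v *.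
rewrite ltnS => ij_k ui vj.
case: i => [|i] in ui ij_k *; first by rewrite -[u]mulmx1 ui !mul0mx.
case: j => [|j] in vj ij_k *.
  by rewrite -[v]mulmx1 vj linear0 mulmx0 mul0mx.
have step : u *m ad v *m (A - (a + b)%:M) =
    (u *m (A - a%:M)) *m ad v + u *m ad (v *m (A - b%:M)).
  have -> : ad (v *m (A - b%:M)) = ad v *m A - A *m ad v - b *: ad v.
    by rewrite mulmxBr mul_mx_scalar [LHS]linearB [ad (b *: v)]linearZ derA.
  rewrite !(mulmxBr, mulmxBl) !mul_mx_scalar -scalemxAl -scalemxAr !mulmxA.
  by rewrite scalerDl opprD [RHS]addrC addrACA subrK [- (b *: _) - _]addrC.
rewrite addSn exprS mulmxA step mulmxDl IHk ?add0r //; last first.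
  by rewrite -mulmxA mulmxE -exprS.
rewrite addnS -addSn IHk //; last by rewrite -mulmxA mulmxE -exprS.
by rewrite addSn -addnS.
Qed.


(** Primary decomposition. The exponent [size s] bounds every multiplicity in s, so it serves for
    all eigenvalues at once. *)
Lemma geigen_decomposition A (s : seq K) :
    mxminpoly A %| \prod_(z <- s) ('X - z%:P) -> forall u,
  exists2 c : 'I_(size (undup s)) -> 'rV_n.+1,
    u = \sum_i c i & forall i, c i *m (A - ((undup s)`_i)%:M) ^+ size s = 0.
Proof.
move=> sA u; set r := undup s; set m := size s.
have hornerXm z : horner_mx A (('X - z%:P) ^+ m) = (A - z%:M) ^+ m.
  by rewrite rmorphXn rmorphB /= horner_mx_X horner_mx_C.
have min_dv : mxminpoly A %| \prod_(i < size r) ('X - (r`_i)%:P) ^+ m.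
  rewrite (dvdp_trans sA) //.
  rewrite -(big_mkord predT (fun i => ('X - (r`_i)%:P) ^+ m)).
  rewrite -(big_nth 0 predT (fun z => ('X - z%:P) ^+ m)) -prodr_undup_exp_count.
  apply: (big_ind2 (fun p q => p %| q)) => // [p1 p2 q1 q2|z _].
    exact: dvdp_mul.
  by rewrite dvdp_exp2l // count_size.
have cop : {in xpredT &, forall i j : 'I_(size r), j != i ->
    coprimep (('X - (r`_i)%:P) ^+ m) (('X - (r`_j)%:P) ^+ m)}.
  move=> i j _ _ ji; rewrite coprimep_expl // coprimep_expr //.
  by rewrite coprimep_XsubC root_XsubC nth_uniq ?undup_uniq.
have : (u <= \sum_i kermxpoly A (('X - (r`_(i : 'I_(size r)))%:P) ^+ m))%MS.
  by rewrite -(kermxpoly_prod _ cop) (kermxpoly_min min_dv) submx1.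
case/sub_sumsmxP=> c uE.
exists (fun i => c i *m kermxpoly A (('X - (r`_i)%:P) ^+ m)) => //.
by move=> i; rewrite -hornerXm -mulmxA mulmx_ker mulmx0.
Qed.

Lemma horner_geigen A a phi m (g : {poly K}) w :
    w *m (A - a%:M) ^+ m = 0 -> ('X - a%:P) ^+ m %| g - phi%:P ->
  w *m horner_mx A g = phi *: w.
Proof.
move=> wA /dvdpP[h gE]; rewrite -[g](subrK phi%:P) gE mulrC rmorphD rmorphM.
rewrite rmorphXn rmorphB /= horner_mx_X !horner_mx_C mulmxDr mul_mx_scalar.
by rewrite -mulmxE mulmxA wA mul0mx add0r.
Qed.

(* [horner_mx A g] acts as [phi z] on the generalized eigenspace of z, and      *)
(* phi is additive wherever the product of two eigenspaces does not vanish.     *)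
Lemma der_horner A (s : seq K) (phi : K -> K) (g : {poly K}) :
    mxminpoly A %| \prod_(z <- s) ('X - z%:P) -> ad_derivation A ->
    (forall z, z \in s -> ('X - z%:P) ^+ (size s + size s) %| g - (phi z)%:P) ->
    {in s &, forall a b, a + b \in s -> phi (a + b) = phi a + phi b} ->
  ad_derivation (horner_mx A g).
Proof.
move=> sA derA gE phiD v; set D := horner_mx A g; set m := size s in gE *.
suff main u : u *m ad v *m D = u *m D *m ad v + u *m ad (v *m D).
  apply/row_matrixP => i; rewrite !rowE mulmxBr !mulmxA main.
  by rewrite [X in X - _]addrC addrK.
have [c -> c0] := geigen_decomposition sA u.
have [e vE e0] := geigen_decomposition sA v.
have sE (i : 'I_(size (undup s))) : (undup s)`_i \in s.
  by rewrite -mem_undup mem_nth.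
have XE z w : z \in s -> w *m (A - z%:M) ^+ m = 0 -> w *m D = phi z *: w.
  move=> zs w0; apply: (horner_geigen w0); apply: dvdp_trans (gE z zs).
  by rewrite dvdp_exp2l // leq_addr.
rewrite !mulmx_suml -big_split; apply: eq_bigr => i _ /=.
rewrite vE [in ad (_ *m D)]mulmx_suml ![ad (\sum_(j < _) _)]linear_sum.
rewrite !mulmx_sumr mulmx_suml -big_split; apply: eq_bigr => j _ /=.
set a := (undup s)`_i; set b := (undup s)`_j.
rewrite (XE a _ (sE i) (c0 i)) (XE b _ (sE j) (e0 j)) linearZ /=.
rewrite -scalemxAl -scalemxAr -scalerDl.
(* The product is killed by (A - (a + b))^(m + m), hence the doubled exponent imposed on g. If a + b
   is not in s, it is not an eigenvalue and the product vanishes. *)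
have w0 := der_geigen derA (c0 i) (e0 j).
have [abs|abNs] := boolP (a + b \in s).
  by rewrite (horner_geigen w0 (gE _ abs)) phiD ?sE.
suff -> : c i *m ad (e j) = 0 by rewrite mul0mx scaler0.
have : A - (a + b)%:M \in unitmx.
  rewrite -row_free_unit -kermx_eq0; apply: contraNT abNs.
  rewrite -[kermx _]/(eigenspace A (a + b)) => /negbTE ab.
  have : eigenvalue A (a + b) by rewrite /eigenvalue /eigenspace ab.
  rewrite eigenvalue_root_min root_factor_theorem => /dvdp_trans/(_ sA).
  by rewrite -root_factor_theorem root_prod_XsubC.
move=> uA; have uAm : (A - (a + b)%:M) ^+ (m + m) \in unitmx := unitrX _ uA.
by rewrite -[LHS](mulmxK uAm) w0 mul0mx.
Qed.


(** As x is a sum of products [w, y], its trace against a derivation D vanishes: tr(ad [w, y] D) =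
    tr(ad w (ad y D - D ad y)) = tr(ad w ad(yD)) = 0. Finitely many rational relations stand in for
    a Q-linear functional on the span of the eigenvalues. *)
Lemma ad_nilpotent_of_killing0 (charK0 : [pchar K] =i pred0) (I : finType)
    (x : 'rV_n.+1) (w y : I -> 'rV_n.+1) (s : seq K) :
    (forall u v, ad (u *m ad v) = ad u *m ad v - ad v *m ad u) ->
    (forall u v, \tr (ad u *m ad v) = 0) ->
    x = \sum_i w i *m ad (y i) ->
    char_poly (ad x) = \prod_(z <- s) ('X - z%:P) ->
  ad x ^+ n.+1 = 0.
Proof.
move=> adM kil0 xE char_s; set A := ad x.
have [f _] := rat_rmorphism charK0.
have derA : ad_derivation A by move=> v; rewrite /A adM.
have [|P uP [T trT PA]] := @trigonalizable_of_split _ _ A s.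
  have := Cayley_Hamilton A; rewrite char_s rmorph_prod /= => <-.
  by apply: eq_bigr => z _; rewrite rmorphB /= horner_mx_X horner_mx_C.
have hornP p : P *m horner_mx A p = horner_mx T p *m P.
  elim/poly_ind: p => [|p c IHp]; first by rewrite !rmorph0 mulmx0 mul0mx.
  rewrite !rmorphD !rmorphM /= !horner_mx_X !horner_mx_C mulmxDr mulmxDl.
  by rewrite -!mulmxE mulmxA IHp -!mulmxA PA !mulmxA mul_scalar_mx mul_mx_scalar.
have hornA p : horner_mx A p = invmx P *m (horner_mx T p *m P).
  by rewrite -hornP mulKmx.
pose mu i := T i i.
have muA : horner_mx A (\prod_(z <- codom mu) ('X - z%:P)) = 0.
  rewrite hornA (_ : \prod_(z <- _) _ = char_poly T).
    by rewrite Cayley_Hamilton mul0mx mulmx0.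
  by rewrite char_poly_trig // codomE big_map enumT.
(* [None] encodes mu_i = mu_j and [Some k] encodes mu_i + mu_j = mu_k; a relation that fails
   contributes a zero row. *)
pose rel (t : 'I_n.+1 * 'I_n.+1 * option 'I_n.+1) : 'rV[rat]_n.+1 :=
  let: (i, j, k) := t in
  if k is Some k then
    if mu i + mu j == mu k then
      delta_mx 0 i + delta_mx 0 j - delta_mx 0 k else 0
  else if mu i == mu j then delta_mx 0 i - delta_mx 0 j else 0.
pose S := \matrix_(t < #|{: 'I_n.+1 * 'I_n.+1 * option 'I_n.+1}|)
  rel (enum_val t).
have mu0 : \col_i mu i = 0.
  apply: (@eq0_of_relations _ f _ _ S) => [|q qS].
    apply/row_matrixP => t; rewrite row_mul -map_row rowK row0.
    have mapd i : map_mx f (delta_mx 0 i) *m (\col_i mu i) = (mu i)%:M.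
      by rewrite map_delta_mx -rowE; apply/matrixP => a b; rewrite !mxE !ord1.
    case: (enum_val t) => [[i j] [k|]] /=; case: eqP => [e|_];
      rewrite ?map_mx0 ?mul0mx // !(map_mxB, map_mxD) !(mulmxBl, mulmxDl) !mapd.
      by rewrite -raddfD /= e subrr.
    by rewrite e subrr.
  have q_rel t : q *m (rel t)^T = 0.
    have -> : rel t = row (enum_rank t) S by rewrite rowK enum_rankK.
    rewrite tr_row colE mulmxA qS mul0mx.
    by apply/matrixP => a b; rewrite !mxE.
  have qd i : q *m (delta_mx 0 i)^T = (q 0 i)%:M.
    by rewrite trmx_delta -colE; apply/matrixP => a b; rewrite !mxE !ord1.
  have scal_inj (a : rat) : a%:M = 0 :> 'M_1 -> a = 0.
    by move/matrixP/(_ 0 0); rewrite !mxE eqxx.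
  have q2 i j : mu i = mu j -> q 0 i = q 0 j.
    move=> e; have := q_rel (i, j, None).
    rewrite /rel e eqxx linearB /= mulmxBr !qd -raddfB /= => /scal_inj/eqP.
    by rewrite subr_eq0 => /eqP.
  have q3 i j k : mu i + mu j = mu k -> q 0 k = q 0 i + q 0 j.
    move=> e; have := q_rel (i, j, Some k).
    rewrite /rel e eqxx linearB /= [(_ + _)^T]linearD /= mulmxBr mulmxDr !qd.
    rewrite -raddfD -raddfB /= => /scal_inj/eqP.
    by rewrite subr_eq0 => /eqP.
  (* By [q2] the value does not depend on the index picked; off the spectrum 0 is a dummy. *)
  pose phi z := if [pick i | mu i == z] is Some i then f (q 0 i) else 0.
  have phiE i : phi (mu i) = f (q 0 i).
    rewrite /phi; case: pickP => [j /eqP e|/(_ i)]; last by rewrite eqxx.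
    by rewrite (q2 _ _ e).
  pose r := codom mu.
  have [g gE] := poly_interpolation (size r + size r) phi (undup_uniq r).
  have {}gE z : z \in r -> ('X - z%:P) ^+ (size r + size r) %| g - (phi z)%:P.
    by rewrite -mem_undup; apply: gE.
  have phiD : {in r &, forall a b, a + b \in r -> phi (a + b) = phi a + phi b}.
    move=> _ _ /codomP[i ->] /codomP[j ->] /codomP[k e].
    by rewrite e !phiE (q3 _ _ _ e) rmorphD.
  have derg := der_horner (mxminpoly_min muA) derA gE phiD.
  have : \tr (A *m horner_mx A g) = 0.
    rewrite /A {1}xE linear_sum mulmx_suml raddf_sum big1 // => i _ /=.
    rewrite adM mulmxBl raddfB /= -!mulmxA [\tr (ad (y i) *m _)]mxtrace_mulC.
    by rewrite -mulmxA -raddfB -mulmxBr -derg /= kil0.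
  (* In triangular form the trace of A g(A) is the sum of the mu_i g(mu_i), where g(mu_i) is the
     image of q_i. *)
  have -> : A *m horner_mx A g = horner_mx A ('X * g).
    by rewrite rmorphM /= horner_mx_X.
  rewrite hornA mxtrace_mulC mulmxK // mxtrace_horner_trig // => trg.
  apply/matrixP => a b; rewrite !mxE !ord1 -[RHS]trg; apply: eq_bigr => i _.
  rewrite !mxE hornerM hornerX mulrC; congr (_ * _).
  have /dvdpP[h hE] := gE (mu i) (codom_f _ _).
  have r_gt0 : (0 < size r)%N by rewrite size_codom card_ord.
  rewrite -phiE -[g](subrK (phi (mu i))%:P) hE hornerD hornerM hornerC.
  rewrite horner_exp hornerXsubC subrr expr0n addn_eq0 (gtn_eqF r_gt0).
  by rewrite mulr0 add0r.
move: muA; rewrite (eq_big_seq (fun=> 'X)) => [|_ /codomP[i ->]].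
  rewrite big_const_seq iter_mulr_1 count_predT size_codom card_ord.
  by rewrite rmorphXn /= horner_mx_X.
by move/colP/(_ i): mu0; rewrite !mxE => ->; rewrite subr0.
Qed.

End Derivations.

Section SimpleLie.

Context {F : fieldType} {n : nat}.
Variable ad : {linear 'rV[F]_n.+1 -> 'M[F]_n.+1}.
Hypothesis adM :
  forall u v, ad (u *m ad v) = ad u *m ad v - ad v *m ad u.
Implicit Types (u v w x z : 'rV[F]_n.+1) (U W J D : 'M[F]_n.+1).

Lemma killing_assoc u v w :
  \tr (ad (u *m ad v) *m ad w) = \tr (ad u *m ad (v *m ad w)).
Proof.
rewrite !adM mulmxBl mulmxBr !raddfB /= !mulmxA; congr (_ - _).
by rewrite -(mulmxA (ad v)) [LHS]mxtrace_mulC.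
Qed.

(** Extend [ad] linearly to a splitting field E of its characteristic polynomial at x. The
    hypotheses are linear in each argument, so they need checking only on vectors from F; nilpotency
    descends because [map_mx f] is injective. *)
Lemma ad_nilpotent (charF0 : [pchar F] =i pred0) (I : finType) x
    (w y : I -> 'rV_n.+1) :
    (forall u v, \tr (ad u *m ad v) = 0) ->
    x = \sum_i w i *m ad (y i) ->
  ad x ^+ n.+1 = 0.
Proof.
move=> kil0 xE.
have [E [f [s char_s]]] := split_field_exists (char_poly_monic (ad x)).
pose adE (v : 'rV[E]_n.+1) := \sum_j v 0 j *: map_mx f (ad (delta_mx 0 j)).
have adE_lin : linear adE.
  move=> a u v; rewrite /adE scaler_sumr -big_split; apply: eq_bigr => j _ /=.
  by rewrite !mxE scalerDl scalerA.
pose ade : {linear 'rV[E]_n.+1 -> 'M[E]_n.+1} :=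
  HB.pack adE (GRing.isLinear.Build E _ _ _ adE adE_lin).
have adeE v : ade (map_mx f v) = map_mx f (ad v).
  rewrite [in RHS](row_sum_delta v) linear_sum /= map_mx_sum.
  by apply: eq_bigr => j _; rewrite linearZ /= map_mxZ !mxE.
have ade_ind (P : 'rV[E]_n.+1 -> Prop) :
    P 0 -> (forall a (u v : 'rV[E]_n.+1), P u -> P v -> P (a *: u + v)) ->
    (forall u, P (map_mx f u)) -> forall u : 'rV[E]_n.+1, P u.
  move=> P0 PD Pf u; rewrite (row_sum_delta u).
  elim: (index_enum _) => [|i r IHr]; first by rewrite big_nil.
  by rewrite big_cons; apply: PD => //; rewrite -(map_delta_mx f).
have adeP a (u v : 'rV[E]_n.+1) : ade (a *: u + v) = a *: ade u + ade v.
  exact: linearP.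
have adeM (u v : 'rV[E]_n.+1) :
    ade (u *m ade v) = ade u *m ade v - ade v *m ade u.
  move: u; apply: (@ade_ind) => [|a u1 u2 IH1 IH2|u].
  - by rewrite !(mul0mx, mulmx0, linear0, subr0).
  - rewrite mulmxDl -scalemxAl !adeP IH1 IH2 mulmxDl mulmxDr.
    by rewrite -scalemxAl -scalemxAr scalerBr opprD addrACA.
  move: v; apply: (@ade_ind) => [|a u1 u2 IH1 IH2|v].
  - by rewrite !(mul0mx, mulmx0, linear0, subr0).
  - rewrite adeP mulmxDr -scalemxAr !adeP IH1 IH2 mulmxDl mulmxDr.
    by rewrite -scalemxAl -scalemxAr scalerBr opprD addrACA.
  by rewrite !adeE -map_mxM adeE adM map_mxB !map_mxM.
have kilE (u v : 'rV[E]_n.+1) : \tr (ade u *m ade v) = 0.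
  move: u; apply: (@ade_ind) => [|a u1 u2 IH1 IH2|u].
  - by rewrite linear0 mul0mx mxtrace0.
  - by rewrite adeP mulmxDl -scalemxAl linearP /= IH1 IH2 mulr0 addr0.
  move: v; apply: (@ade_ind) => [|a u1 u2 IH1 IH2|v].
  - by rewrite linear0 mulmx0 mxtrace0.
  - by rewrite adeP mulmxDr -scalemxAr linearP /= IH1 IH2 mulr0 addr0.
  by rewrite !adeE -map_mxM trace_map_mx kil0 rmorph0.
have charE0 : [pchar E] =i pred0 by move=> p; rewrite (fmorph_pchar f).
have : ade (map_mx f x) ^+ n.+1 = 0.
  apply: (ad_nilpotent_of_killing0 charE0 adeM kilE
    (w := fun i => map_mx f (w i)) (y := fun i => map_mx f (y i)) (s := s)).
    by rewrite xE map_mx_sum; apply: eq_bigr => i _; rewrite adeE -map_mxM.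
  by rewrite adeE -map_char_poly.
rewrite adeE -(rmorphXn (map_mx f)) => /eqP; rewrite map_mx_eq0 => /eqP.
exact.
Qed.

Hypothesis alt_ad : forall u, u *m ad u = 0.

Lemma ad_anti u v : u *m ad v = - (v *m ad u).
Proof.
apply/eqP; rewrite -addr_eq0; apply/eqP.
have := alt_ad (u + v).
by rewrite linearD /= mulmxDl !mulmxDr !alt_ad add0r addr0 addrC.
Qed.

(* The subalgebra K acts triangularly, on quotients of invariant subspaces too. *)
Definition acts_triangularly (K : 'M[F]_n.+1) :=
  forall U W, (forall k, (k <= K)%MS -> (U *m ad k <= U)%MS) ->
    (forall k, (k <= K)%MS -> (W *m ad k <= W)%MS) -> ~~ (W <= U)%MS ->
  exists w : 'rV_n.+1, [/\ (w <= W)%MS, ~~ (w <= U)%MS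
    & forall k, (k <= K)%MS -> (w *m ad k <= U)%MS].

(** Inductive step of Engel's theorem: K is enlarged by a vector z outside it with [z, K] inside K.
    Vectors of W sent into U by K are stable under z, which is nilpotent, so some such vector
    outside U is sent into U by z too. *)
Lemma acts_triangularly_extend (K : 'M_n.+1) :
    (forall x, ad x ^+ n.+1 = 0) ->
    (forall k, (k <= K)%MS -> (K *m ad k <= K)%MS) -> acts_triangularly K ->
    ~~ row_full K ->
  exists K' : 'M_n.+1,
    [/\ (forall k, (k <= K')%MS -> (K' *m ad k <= K')%MS),
        acts_triangularly K' & (\rank K < \rank K')%N].
Proof.
(* The triangular action of K on the whole space modulo K itself provides z. *)
move=> nilp subK triK; rewrite -sub1mx => /(triK K 1%:M subK).
case=> [k _|z [_ zNK zK]]; first exact: submx1.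
exists (K + <<z>>)%MS; set K' := (K + _)%MS.
have KK' : (K <= K')%MS by exact: addsmxSl.
have zK' : (z <= K')%MS by rewrite (submx_trans _ (addsmxSr _ _)) ?genmxE.
have K'P k : (k <= K')%MS -> exists2 a, (a <= K)%MS & exists t, k = a + t *: z.
  case/sub_addsmxP=> -[c1 c2] /= ->; exists (c1 *m K); first exact: submxMl.
  have /sub_rVP[t ->] : (c2 *m <<z>> <= z)%MS.
    by rewrite (submx_trans (submxMl _ _)) ?genmxE.
  by exists t.
have stabP U : (forall k, (k <= K')%MS -> (U *m ad k <= U)%MS) <->
    (forall k, (k <= K)%MS -> (U *m ad k <= U)%MS) /\ (U *m ad z <= U)%MS.
  split=> [H|[HK Hz] k /K'P[a aK [t ->]]].
    by split=> [k kK|]; apply: H => //; apply: submx_trans kK KK'.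
  rewrite linearD linearZ /= mulmxDr -scalemxAr addmx_sub ?scalemx_sub //.
  exact: HK.
split.
- apply/stabP; split=> [k kK|].
    rewrite addsmxMr addsmx_sub (submx_trans (subK k kK)) //=.
    have /submxP[c zE] : (<<z>> <= z)%MS by rewrite genmxE.
    by rewrite zE -mulmxA (submx_trans (submxMl _ _)) // (submx_trans (zK k kK)).
  rewrite addsmxMr addsmx_sub; apply/andP; split.
    apply/row_subP => i; rewrite row_mul ad_anti eqmx_opp.
    by rewrite (submx_trans _ KK') // zK // row_sub.
  have /submxP[c zE] : (<<z>> <= z)%MS by rewrite genmxE.
  by rewrite zE -mulmxA alt_ad mulmx0 sub0mx.
- move=> U W /stabP[UK Uz] /stabP[WK Wz] WU.
  have [w0 [w0W w0U w0K]] := triK U W UK WK WU.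
  pose w m := w0 *m ad z ^+ m.
  have wS m : w m.+1 = w m *m ad z by rewrite /w exprSr mulmxA.
  have wW m : (w m <= W)%MS.
    elim: m => [|m IHm]; first by rewrite /w expr0 mulmx1.
    by rewrite wS (submx_trans (submxMr _ IHm)).
  have wK m k : (k <= K)%MS -> (w m *m ad k <= U)%MS.
    elim: m k => [|m IHm] k kK; first by rewrite /w expr0 mulmx1 w0K.
    have -> : w m.+1 *m ad k = w m *m ad (z *m ad k) + w m *m ad k *m ad z.
      by rewrite wS adM mulmxBr !mulmxA subrK.
    by rewrite addmx_sub ?IHm ?zK // (submx_trans (submxMr _ (IHm _ kK))).
  have exm : exists m, (w m <= U)%MS.
    by exists n.+1; rewrite /w nilp mulmx0 sub0mx.
  (* The last iterate before entering U is the vector sought; index 0 is excluded since w0 is not in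
     U. *)
  case: (ex_minnP exm) => -[|m] wU min_m.
    by rewrite /w expr0 mulmx1 (negbTE w0U) in wU.
  exists (w m); split=> // [|k /K'P[a aK [t ->]]].
    by apply/negP => /min_m; rewrite ltnn.
  rewrite linearD linearZ /= mulmxDr -scalemxAr.
  by rewrite addmx_sub ?scalemx_sub ?(wK m a) // -wS.
rewrite ltn_neqAle mxrankS // andbT; apply: contraNneq zNK => rK.
by rewrite (submx_trans zK') // -(mxrank_leqif_sup KK') rK.
Qed.

(** Enlarge K from 0 to the whole space, then use its triangular action with U = 0. *)
Lemma engel : (forall x, ad x ^+ n.+1 = 0) ->
  exists2 w : 'rV[F]_n.+1, w != 0 & forall v, w *m ad v = 0.
Proof.
move=> nilp.
suff [K [triK fullK]] : exists K : 'M_n.+1, acts_triangularly K /\ row_full K.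
  have [||| w [_ w0 wK]] := triK 0 1%:M.
  - by move=> k _; rewrite mul0mx sub0mx.
  - by move=> k _; rewrite submx1.
  - by rewrite submx0 oner_eq0.
  exists w => [|v]; first by rewrite -submx0.
  by apply/eqP; rewrite -submx0 wK // submx_full.
suff main r : (r <= n.+1)%N -> exists K : 'M_n.+1,
    [/\ (forall k, (k <= K)%MS -> (K *m ad k <= K)%MS),
        acts_triangularly K & (r <= \rank K)%N].
  have [K [_ triK rK]] := main _ (leqnn _).
  by exists K; split; rewrite // /row_full eqn_leq rank_leq_row.
elim: r => [|r IHr] rn.
  exists 0; split=> // [k|U W _ _ /row_subPn[i iW]].
    by rewrite mul0mx sub0mx.
  exists (row i W); split=> // [|k]; first exact: row_sub.
  by rewrite submx0 => /eqP->; rewrite linear0 mulmx0 sub0mx.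
have [K [subK triK rK]] := IHr (ltnW rn).
have [fK|NfK] := boolP (row_full K).
  by exists K; split=> //; rewrite (eqP fK).
have [K' [subK' triK' KK']] := acts_triangularly_extend nilp subK triK NfK.
by exists K'; split=> //; apply: leq_ltn_trans KK'.
Qed.

(** * The Killing form and inner derivations *)

Hypothesis charF0 : [pchar F] =i pred0.
Hypothesis simple_ad : forall J, (forall v, (J *m ad v <= J)%MS) ->
  J = 0 \/ row_full J.
Hypothesis ad_neq0 : exists v, ad v != 0.

(** The derived algebra J is a nonzero ideal, hence everything, so Cartan's criterion reaches every
    x. The vector given by Engel's theorem spans an ideal, again everything, which forces [ad] to
    vanish. *)
Lemma killing_nonzero : ~ forall u v, \tr (ad u *m ad v) = 0.
Proof.
move=> kil0; have [v0 adv0] := ad_neq0.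
pose J := (\sum_j ad (delta_mx 0 j))%MS.
have adJ v : (ad v <= J)%MS.
  rewrite (row_sum_delta v) linear_sum summx_sub // => j _.
  by rewrite linearZ scalemx_sub // (sumsmx_sup j).
have [|J0|fullJ] := simple_ad (J := J).
- by move=> v; apply: submx_trans (submxMl _ _) (adJ v).
- by move: (adJ v0); rewrite J0 submx0 (negbTE adv0).
have [|w w0 wad] := engel.
  move=> x; have /sub_sumsmxP[c xE] : (x <= J)%MS by rewrite submx_full.
  exact: ad_nilpotent charF0 _ _ _ _ kil0 xE.
have [|w_0|fullw] := simple_ad (J := <<w>>%MS).
- move=> v; have /submxP[c ->] : (<<w>> <= w)%MS by rewrite genmxE.
  by rewrite -mulmxA wad mulmx0 sub0mx.
- by case/negP: w0; rewrite -submx0 -(genmxE w) w_0 sub0mx.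
case/negP: adv0; apply/eqP/row_matrixP => i; rewrite row0 rowE.
have wi : ((delta_mx 0 i : 'rV_n.+1) <= w)%MS.
  by rewrite (submx_trans (submx_full _ fullw)) ?genmxE.
case/submxP: wi => c ->.
by rewrite -mulmxA wad mulmx0.
Qed.

(** The kernel of the Gram matrix K is an ideal by invariance, hence 0. Choose a with tr(ad a ad v)
    = tr(D ad v) for all v. Then E = D - ad a is a derivation of trace 0 against every ad v, so
    tr(ad(uE) ad v) = tr(E ad [v, u]) = 0 and uE = 0. *)
Lemma derivation_inner D :
  (forall v, ad (v *m D) = ad v *m D - D *m ad v) -> exists a, D = ad a.
Proof.
move=> derD.
pose K : 'M[F]_n.+1 :=
  \matrix_(i, j) \tr (ad (delta_mx 0 i) *m ad (delta_mx 0 j)).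
have KE u v : (u *m K *m v^T) 0 0 = \tr (ad u *m ad v).
  rewrite {2}(row_sum_delta v) linear_sum mulmx_sumr raddf_sum mxE.
  apply: eq_bigr => j _ /=; rewrite !mxE linearZ /= -scalemxAr linearZ /= mulrC.
  congr (_ * _); rewrite {2}(row_sum_delta u) linear_sum mulmx_suml raddf_sum.
  by apply: eq_bigr => i _ /=; rewrite !mxE linearZ /= -scalemxAl linearZ.
have kerK u : u *m K = 0 <-> forall v, \tr (ad u *m ad v) = 0.
  split=> [uK v|uK]; first by rewrite -KE uK mul0mx mxE.
  apply/rowP => j; rewrite [RHS]mxE -[RHS](uK (delta_mx 0 j)) -KE.
  by rewrite trmx_delta -colE [RHS]mxE.
have [|kerK0|] := simple_ad (J := kermx K); last 2 first.
- have uK : K \in unitmx by rewrite -row_free_unit -kermx_eq0 kerK0.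
  pose b := \row_j \tr (D *m ad (delta_mx 0 j)).
  pose a := b *m invmx K; exists a.
  pose E := D - ad a.
  have trE v : \tr (E *m ad v) = 0.
    rewrite (row_sum_delta v) linear_sum mulmx_sumr raddf_sum big1 // => j _.
    rewrite linearZ /= -scalemxAr linearZ /= mulmxBl raddfB /= -KE.
    by rewrite mulmxKV // trmx_delta -colE !mxE subrr mulr0.
  have derE v : ad (v *m E) = ad v *m E - E *m ad v.
    rewrite mulmxBr linearB /= derD adM mulmxBr mulmxBl !opprB.
    by rewrite addrACA [RHS]addrACA [- (D *m _) - _]addrC.
  apply/eqP; rewrite -subr_eq0 -/E; apply/eqP/row_matrixP => i.
  rewrite row0 rowE; set u := delta_mx 0 i.
  suff : u *m E *m K = 0 by move/(canRL (mulmxK uK)); rewrite mul0mx.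
  apply/kerK => v; rewrite derE mulmxBl raddfB /=.
  have -> : \tr (ad u *m E *m ad v) = \tr (E *m (ad v *m ad u)).
    by rewrite [LHS]mxtrace_mulC (mulmxA (ad v)) [LHS]mxtrace_mulC.
  by rewrite -mulmxA -raddfB -mulmxBr -adM /= trE.
- rewrite -sub1mx => fullK; case: killing_nonzero => u v.
  have /sub_kermxP/kerK : (u <= kermx K)%MS by rewrite submx_full // -sub1mx.
  exact.
move=> v; apply/row_subP => i; rewrite row_mul; apply/sub_kermxP/kerK => w.
rewrite killing_assoc; apply: (kerK _).1.
by rewrite -row_mul mulmx_ker row0.
Qed.

End SimpleLie.

(** * Coordinates on a subalgebra *)

Section SubspaceLie.

Context {F : fieldType} {L : vectType F}.
Variable br : {bilinear L -> L -> L}.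

Definition rmul (a : L) : 'End(L) := linfun (applyr br a).

Lemma rmulE a x : rmul a x = br x a.
Proof. by rewrite lfunE. Qed.

Lemma rmul_is_linear : linear rmul.
Proof.
move=> a u v; apply/lfunP => x.
by rewrite add_lfunE scale_lfunE !rmulE linearPr.
Qed.
HB.instance Definition _ := GRing.isLinear.Build F L _ _ rmul rmul_is_linear.

Variables (n : nat) (b : n.+1.-tuple L).

Definition of_row (u : 'rV[F]_n.+1) : L := \sum_i u 0 i *: b`_i.

Lemma of_row_is_linear : linear of_row.
Proof.
move=> a u v; rewrite /of_row scaler_sumr -big_split; apply: eq_bigr => i _ /=.
by rewrite !mxE scalerDl scalerA.
Qed.
HB.instance Definition _ :=
  GRing.isLinear.Build F _ _ _ of_row of_row_is_linear.

(** This represents f on the span of b only when f preserves that span. *)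
Definition mx_of (f : 'End(L)) : 'M[F]_n.+1 := \matrix_(i, j) coord b j (f b`_i).

Lemma mx_of_is_linear : linear mx_of.
Proof.
move=> a f g; apply/matrixP => i j.
by rewrite !mxE add_lfunE scale_lfunE linearP.
Qed.
HB.instance Definition _ :=
  GRing.isLinear.Build F _ _ _ mx_of mx_of_is_linear.

Definition ad_row : {linear 'rV[F]_n.+1 -> 'M[F]_n.+1} := mx_of \o rmul \o of_row.

Variable G : {vspace L}.
Hypothesis bG : basis_of G b.

Lemma of_row_mem u : of_row u \in G.
Proof.
apply: memv_suml => i _; apply/memvZ/(basis_mem bG).
by rewrite mem_nth ?size_tuple.
Qed.

Lemma of_row_inj : injective of_row.
Proof.
move=> u v uv; apply/rowP => i.
by rewrite -!(coord_sum_free _ _ (basis_free bG)) -/(of_row _) uv.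
Qed.

Lemma of_row_onto x : x \in G -> exists u, x = of_row u.
Proof.
move=> xG; exists (\row_i coord b i x); rewrite [LHS](coord_basis bG xG).
by apply: eq_bigr => i _; rewrite mxE.
Qed.

Lemma of_row_mx_of (f : 'End(L)) u :
  {in G, forall x, f x \in G} -> of_row (u *m mx_of f) = f (of_row u).
Proof.
move=> fG; have fuG := fG _ (of_row_mem u).
rewrite [RHS](coord_basis bG fuG); apply: eq_bigr => j _; congr (_ *: _).
rewrite mxE /of_row !linear_sum; apply: eq_bigr => i _ /=.
by rewrite !linearZ mxE.
Qed.

Lemma of_row_ad u v : subalgebra br G ->
  of_row (u *m ad_row v) = br (of_row u) (of_row v).
Proof.
move=> subG; rewrite of_row_mx_of ?rmulE // => x xG.
by rewrite rmulE subG ?of_row_mem.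
Qed.

End SubspaceLie.

Lemma simple_lie_derivation_inner (F : fieldType) (charF0 : [pchar F] =i pred0)
    (L : vectType F) (br : {bilinear L -> L -> L}) (G : {vspace L})
    (D : 'End(L)) :
    right_leibniz br -> lie_subalgebra br G ->
    (forall J : {vspace L}, (J <= G)%VS ->
      (forall x u, x \in J -> u \in G -> br x u \in J) -> J = 0%VS \/ J = G) ->
    (exists u v, [/\ u \in G, v \in G & br u v != 0]) ->
    {in G, forall x, D x \in G} ->
    {in G &, forall x y, D (br x y) = br (D x) y + br x (D y)} ->
  exists2 a, a \in G & {in G, forall x, D x = br x a}.
Proof.
move=> leib [subG altG _] simG nonab DG derD.
have [n [b bG]] : exists n (b : n.+1.-tuple L), basis_of G b.
  move: (vbasisP G) nonab; move: (vbasis G); case: (\dim G) => [|n] b bG.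
    case=> u [v []]; rewrite -{1}(span_basis bG) tuple0 span_nil memv0.
    by move=> /eqP->; rewrite linear0l eqxx.
  by exists n, b.
pose ad := ad_row br b; pose e := of_row b.
have eG u : e u \in G := of_row_mem bG u.
have eI := of_row_inj bG : injective e.
have eD u v : e (u + v) = e u + e v by exact: linearD.
have eN u : e (- u) = - e u by exact: linearN.
have eadE u v : e (u *m ad v) = br (e u) (e v) := of_row_ad bG u v subG.
pose D' := mx_of b D.
have eD'E u : e (u *m D') = D (e u) := of_row_mx_of bG u DG.
have mxP (A B : 'M[F]_n.+1) : (forall u, e (u *m A) = e (u *m B)) -> A = B.
  by move=> AB; apply/row_matrixP => i; rewrite !rowE; apply/eI/AB.
have [||| |v|a Da] := @derivation_inner F n ad _ _ charF0 _ _ D'.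
- move=> u v; apply: mxP => w.
  by rewrite mulmxBr eD eN !mulmxA !eadE leib.
- by move=> u; apply: eI; rewrite eadE altG // [RHS]linear0.
(* The image of h is the row space of J, seen as a subspace of G. *)
- move=> J Jad; pose h := linfun (e \o mulmxr J).
  have hE u : h u = e (u *m J) by rewrite lfunE.
  have [||h0|hG] := simG (limg h).
  + by apply/subvP => _ /memv_imgP[u _ ->]; rewrite hE.
  + move=> _ y /memv_imgP[u _ ->] /(of_row_onto bG)[v ->]; rewrite hE.
    have /submxP[w Jw] : (u *m J *m ad v <= J)%MS.
      by rewrite -mulmxA (submx_trans (submxMl _ _)).
    by rewrite -eadE Jw -hE memv_img ?memvf.
  + left; apply: mxP => u; rewrite mulmx0 -hE [RHS]linear0; apply/eqP.
    by rewrite -memv0 -h0 memv_img ?memvf.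
  right; rewrite -sub1mx; apply/row_subP => i.
  have : e (row i 1%:M) \in limg h by rewrite hG.
  by case/memv_imgP=> w _; rewrite hE => /eI ->; rewrite submxMl.
- have [u [v [/(of_row_onto bG)[u' ->] /(of_row_onto bG)[v' ->] uv]]] := nonab.
  exists v'; apply: contraNneq uv => ad0.
  by rewrite -eadE ad0 mulmx0 [e 0]linear0.
- apply: mxP => u; rewrite mulmxBr eD eN !mulmxA eD'E !eadE !eD'E.
  by rewrite derD // [X in _ = X - _]addrC addrK.
exists (e a) => // x /(of_row_onto bG)[u ->].
by rewrite -eD'E Da eadE.
Qed.

(** * Derivations of simple Leibniz algebras *)

Section SimpleLeibniz.

Context {F : fieldType} {L : vectType F}.
Variable br : {bilinear L -> L -> L}.
Hypothesis leibL : right_leibniz br.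
Variables (U I : {vspace L}) (d : 'End(L)).
Hypotheses (U_ideal : ideal_of br fullv U) (U_simple : leibniz_simple br U).
Hypothesis I_squares : squares_ideal br U I.
Hypothesis d_der : derivation_of br fullv d.

Lemma ideal_brl x y : x \in U -> br x y \in U.
Proof. by move=> xU; case: (U_ideal.2 x y xU (memvf y)). Qed.

Lemma ideal_brr x y : y \in U -> br x y \in U.
Proof. by move=> yU; case: (U_ideal.2 y x yU (memvf x)). Qed.

Lemma derivationE x y : d (br x y) = br (d x) y + br x (d y).
Proof. exact: (d_der.2 x y (memvf x) (memvf y)). Qed.

Lemma squares_ideal_uniq J : squares_ideal br U J -> I = J.
Proof.
move=> [idJ sJ minJ]; have [idI sI minI] := I_squares.
by apply: subv_anti; rewrite minI // minJ.
Qed.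

Lemma simple_ideals J : ideal_of br U J -> [\/ J = 0%VS, J = I | J = U].
Proof.
by have [I' [/squares_ideal_uniq <- simU _]] := U_simple => /simU.
Qed.

(** The right factors in U that kill all of L form an ideal, which contains squares because [x,
    [y, y]] = [[x, y], y] - [[x, y], y]. *)
Lemma squares_annihilate x z : z \in I -> br x z = 0.
Proof.
pose ann := lker (linfun (rmul br)).
have annP y : reflect (forall x, br x y = 0) (y \in ann).
  rewrite memv_ker lfunE; apply: (iffP eqP) => [y0 t|y0].
    by rewrite -rmulE y0 lfunE.
  by apply/lfunP => t; rewrite rmulE y0 lfunE.
have [_ _ minI] := I_squares.
suff /subvP sI : (I <= ann :&: U)%VS.
  by move=> /sI; rewrite memv_cap => /andP[/annP].
apply: minI.
  split=> [|y u]; first exact: capvSr.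
  rewrite !memv_cap => /andP[/annP y0 yU] uU; rewrite !ideal_brl // !andbT.
  split; apply/annP => t; last by rewrite y0 linear0r.
  by rewrite leibL !y0 linear0l subr0.
move=> y yU; rewrite memv_cap ideal_brl // andbT; apply/annP => t.
by rewrite leibL subrr.
Qed.

(** [U, U] is an ideal other than I. Were it 0, all squares would vanish and I would be 0 as
    well. *)
Lemma simple_perfect : brv br U U = U.
Proof.
have brU x y : x \in U -> y \in U -> br x y \in brv br U U.
  by move=> xU yU; apply: (brvP br U U _ (subvv _)).
have sbU : (brv br U U <= U)%VS by apply/brvP => x y xU _; apply: ideal_brl.
have idb : ideal_of br U (brv br U U).
  by split=> // x u /(subvP sbU) xU uU; split; apply: brU.
have [I' [/squares_ideal_uniq <- _ nb]] := U_simple.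
have [_ _ minI] := I_squares.
case: (simple_ideals idb) => // b0; case: nb; rewrite b0 //.
apply/esym/eqP; rewrite -subv0 minI //.
  split=> [|x u]; first exact: sub0v.
  by rewrite memv0 => /eqP-> _; rewrite linear0l linear0r mem0v.
by move=> x xU; rewrite -b0 brU.
Qed.

Lemma derivation_stable x : x \in U -> d x \in U.
Proof.
suff : (U <= d @^-1: U)%VS by move=> /subvP sU /sU; rewrite memv_preim.
rewrite -{1}simple_perfect; apply/brvP => y z yU zU.
rewrite -memv_preim derivationE memvD //; first exact: ideal_brr.
exact: ideal_brl.
Qed.

Lemma derivation_squares x : x \in I -> d x \in I.
Proof.
have [[sIU idI] sqI minI] := I_squares.
suff : (I <= d @^-1: I :&: I)%VS.
  by move=> /subvP sI /sI; rewrite memv_cap -memv_preim => /andP[].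
apply: minI.
  split=> [|z u]; first exact: subv_trans (capvSr _ _) sIU.
  rewrite !memv_cap -!memv_preim !derivationE => /andP[dzI zI] uU.
  have duU := derivation_stable uU.
  have [zu uz] := idI z u zI uU; have [zdu duz] := idI z (d u) zI duU.
  have [dzu udz] := idI (d z) u dzI uU.
  by rewrite !memvD ?zu ?uz.
move=> y yU; rewrite memv_cap sqI // andbT -memv_preim derivationE.
have dyU := derivation_stable yU.
(* Polarization writes the derivative of a square as a combination of squares. *)
have -> : br (d y) y + br y (d y) =
    br (d y + y) (d y + y) - br (d y) (d y) - br y y.
  rewrite linearDl !linearDr [br y (d y) + br y y]addrC addrACA.
  by rewrite [X in _ = X - _ - _]addrC -[RHS]addrA -opprD addrK.
by rewrite !memvB ?sqI ?memvD.
Qed.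

Variable G : {vspace L}.
Hypotheses (G_lie : lie_subalgebra br G) (GI_direct : directv (G + I)).
Hypothesis GI_sum : (G + I)%VS = U.


Lemma complement_mem x : x \in G -> x \in U.
Proof. by move=> xG; rewrite -GI_sum -[x]addr0 memv_add ?mem0v. Qed.

(** J + I is an ideal of U, and J is recovered from it because G meets I trivially. *)
Lemma simple_complement_ideals (J : {vspace L}) : (J <= G)%VS ->
    (forall x u, x \in J -> u \in G -> br x u \in J) ->
  J = 0%VS \/ J = G.
Proof.
move=> sJG idJ; have [subG altG _] := G_lie; have [[sIU idI] _ _] := I_squares.
have disj := directv_addP GI_direct.
have antiG x y : x \in G -> y \in G -> br y x = - br x y.
  move=> xG yG; apply/eqP; rewrite -addr_eq0; apply/eqP.
  have := altG (x + y) (memvD xG yG).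
  by rewrite linearDl !linearDr !altG // add0r addr0 addrC.
have : ideal_of br U (J + I).
  split=> [|_ u0 /memv_addP[x xJ [z zI ->]]].
    by rewrite -GI_sum addvS.
  rewrite -GI_sum => /memv_addP[u uG [t tI ->]] {u0}.
  have xG := subvP sJG _ xJ; have xuJ := idJ x u xJ uG.
  have uU := complement_mem uG; have xU := complement_mem xG.
  rewrite !linearDl !linearDr !(squares_annihilate _ tI).
  rewrite !(squares_annihilate _ zI) !addr0 (antiG x u) //.
  split; apply: memv_add => //; rewrite ?memvN //.
    by case: (idI z u zI uU).
  by case: (idI t x tI xU).
case/simple_ideals=> JI.
- by left; apply/eqP; rewrite -subv0 -JI addvSl.
- left; apply/eqP; rewrite -subv0 -disj subv_cap sJG /=.
  by rewrite -[X in (_ <= X)%VS]JI addvSl.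
right; apply/eqP; rewrite eqEsubv sJG /=; apply/subvP => x xG.
have : x \in (J + I)%VS by rewrite JI complement_mem.
case/memv_addP=> y yJ [z zI xE].
have : z \in (G :&: I)%VS.
  rewrite memv_cap zI andbT.
  have -> : z = x - y by rewrite xE addrC addKr.
  by rewrite memvB // (subvP sJG).
by rewrite disj memv0 => /eqP z0; rewrite xE z0 addr0.
Qed.

(** If G were abelian, [U, U] would reduce to [I, G], inside I; perfectness would then give [U, U] =
    I. *)
Lemma complement_nonabelian : exists u v, [/\ u \in G, v \in G & br u v != 0].
Proof.
apply: NNPP => abG; have [[sIU idI] _ _] := I_squares.
have [I' [/squares_ideal_uniq <- _ []]] := U_simple.
rewrite simple_perfect; apply: subv_anti; rewrite sIU andbT.
rewrite -{1}simple_perfect; apply/brvP => x y.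
rewrite -{1 2}GI_sum => /memv_addP[g gG [z zI ->]] /memv_addP[h hG [t tI ->]].
have -> : br (g + z) (h + t) = br z h.
  rewrite linearDl !linearDr !(squares_annihilate _ tI) !addr0.
  rewrite (_ : br g h = 0) ?add0r //; have [//|gh] := eqVneq (br g h) 0.
  by case: abG; exists g, h.
by case: (idI z h zI (complement_mem hG)).
Qed.

Let pG := daddv_pi G I.
Let pI := daddv_pi I G.

Lemma simple_leibniz_derivation (charF0 : [pchar F] =i pred0) :
  exists (a : L) (alpha delta : 'End(L)),
    [/\ a \in G,
        (alpha @: I <= I)%VS /\ (forall x, x \in G -> alpha x = 0),
        (delta @: G <= I)%VS /\ (forall x, x \in I -> delta x = 0),
        (forall x, x \in U -> d x = br x a + alpha x + delta x)
      & (forall x y, x \in U -> y \in U -> alpha (br x y) = br (alpha x) y) /\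
        ((forall x, x \in U -> alpha x = 0) \/ (alpha @: I)%VS = I)].
Proof.
have [subG altG _] := G_lie; have [[sIU idI] _ _] := I_squares.
have disj := directv_addP GI_direct.
have disj' : (I :&: G = 0)%VS by rewrite capvC.
have pGG x : x \in G -> pG x = x by exact: daddv_pi_id.
have pII x : x \in I -> pI x = x by exact: daddv_pi_id.
have pD x : x \in U -> pG x + pI x = x.
  by move=> xU; rewrite daddv_pi_add // GI_sum.
have pGI x : x \in I -> pG x = 0.
  move=> xI; have := pD x (subvP sIU _ xI).
  by rewrite pII // => /(canRL (addrK _)); rewrite subrr.
have pIG x : x \in G -> pI x = 0.
  move=> xG; have := pD x (complement_mem xG).
  by rewrite pGG // => /(canRL (addKr _)); rewrite addNr.
have pGU x : pG x \in U by apply/complement_mem/memv_pi.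
have GU := complement_mem.
have [||||a aG da] :=
    @simple_lie_derivation_inner _ charF0 _ br G (pG \o d)%VF leibL G_lie.
- exact: simple_complement_ideals.
- exact: complement_nonabelian.
- by move=> x _; rewrite comp_lfunE memv_pi.
- move=> x y xG yG; rewrite !comp_lfunE derivationE linearD /=.
  have part (u v : L) : u \in U -> v \in U -> pG (br u v) = br (pG u) (pG v).
    move=> uU vU; rewrite -{1}(pD u uU) -{1}(pD v vU).
    rewrite linearDl !linearDr !(squares_annihilate _ (memv_pi I G _)) !addr0.
    have [bI _] := idI _ _ (memv_pi I G u) (pGU v).
    by rewrite linearD /= (pGI _ bI) addr0 pGG // subG ?memv_pi.
  by rewrite !part ?derivation_stable ?GU // (pGG x) // (pGG y).
pose alpha := ((d - rmul br a) \o pI)%VF.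
have alphaE x : x \in I -> alpha x = d x - br x a.
  by move=> xI; rewrite comp_lfunE pII // add_lfunE opp_lfunE rmulE.
have alphaG x : x \in G -> alpha x = 0.
  by move=> xG; rewrite comp_lfunE pIG // linear0.
have brI x y : x \in I -> y \in U -> br x y \in I.
  by move=> xI yU; case: (idI x y xI yU).
have alphaI x : x \in I -> alpha x \in I.
  by move=> xI; rewrite alphaE // memvB ?derivation_squares ?brI ?GU.
have alpha_br x y : x \in U -> y \in U -> alpha (br x y) = br (alpha x) y.
  rewrite -{1}GI_sum => /memv_addP[g gG [z zI ->]].
  rewrite -GI_sum => /memv_addP[h hG [t tI ->]].
  rewrite !linearDr !(squares_annihilate _ tI) !addr0 linearDl linearD /=.
  have -> : alpha (br g h) = 0 by rewrite alphaG // subG.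
  have -> : alpha (g + z) = alpha z by rewrite linearD /= alphaG ?add0r.
  rewrite add0r.
  rewrite !alphaE ?brI ?GU // derivationE linearBl.
  (* Only the G-component of d h acts on z, and it equals [h, a]; the Leibniz identity then moves a
     past h. *)
  have -> : br z (d h) = br z (br h a).
    rewrite -[d h]pD ?derivation_stable ?GU // linearDr.
    rewrite (squares_annihilate _ (memv_pi I G _)) addr0.
    by rewrite -da // comp_lfunE.
  by rewrite leibL addrA addrAC addrK.
exists a, alpha, (pI \o d \o pG)%VF; split=> //.
- by split=> //; apply/subvP => _ /memv_imgP[x xI ->]; apply: alphaI.
- split=> [|x xI]; last by rewrite !comp_lfunE pGI // !linear0.
  by apply/subvP => _ /memv_imgP[x xI ->]; rewrite !comp_lfunE memv_pi.
- move=> x; rewrite -{1}GI_sum => /memv_addP[g gG [z zI ->]].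
  have -> : alpha (g + z) = d z - br z a.
    by rewrite linearD /= alphaG // add0r alphaE.
  have -> : (pI \o d \o pG)%VF (g + z) = pI (d g).
    by rewrite !comp_lfunE linearD /= (pGG g) // (pGI z) // addr0.
  rewrite linearD linearDl /= -da // comp_lfunE.
  rewrite -{1}[d g]pD ?derivation_stable ?GU //.
  by rewrite -[_ + br z a + _]addrA [br z a + _]addrC subrK addrAC.
(* Right products stay in the image because alpha commutes with them; left products by elements of I
   vanish. *)
split=> //; have : ideal_of br U (alpha @: I)%VS.
  split=> [|_ u /memv_imgP[x xI ->] uU].
    apply: subv_trans sIU; apply/subvP => _ /memv_imgP[x xI ->]; exact: alphaI.
  rewrite (squares_annihilate _ (alphaI x xI)) mem0v; split=> //.
  by rewrite -alpha_br ?(subvP sIU x) // memv_img // brI.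
case/simple_ideals=> [a0|->|aU]; [left|by right|right].
  move=> x; rewrite -{1}GI_sum => /memv_addP[g gG [z zI ->]].
  rewrite linearD /= alphaG // add0r; apply/eqP.
  by rewrite -memv0 -a0 memv_img.
apply: subv_anti; rewrite {2}aU sIU andbT.
by apply/subvP => _ /memv_imgP[x xI ->]; apply: alphaI.
Qed.

End SimpleLeibniz.

(** * Direct sums of simple ideals *)

Theorem theorem3p5 (F : fieldType) (charF0 : [pchar F] =i pred0)
    (L : vectType F) (br : {bilinear L -> L -> L})
    (leibL : right_leibniz br)
    (s : nat) (Ls Is Gs : 'I_s -> {vspace L})
    (Ls_ideal : forall i, ideal_of br fullv (Ls i))
    (Ls_direct : directv (\sum_(i < s) Ls i))
    (Ls_sum : (\sum_(i < s) Ls i)%VS = fullv)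
    (Ls_simple : forall i, leibniz_simple br (Ls i))
    (Is_squares : forall i, squares_ideal br (Ls i) (Is i))
    (Gs_lie : forall i, lie_subalgebra br (Gs i))
    (GsIs_direct : forall i, directv (Gs i + Is i))
    (GsIs_sum : forall i, (Gs i + Is i)%VS = Ls i)
    (d : 'End(L)) (d_der : derivation_of br fullv d) :
  exists ds : 'I_s -> 'End(L),
    d = \sum_(i < s) ds i /\
    forall i : 'I_s,
      [/\ derivation_of br (Ls i) (ds i),
          forall j x, j != i -> x \in Ls j -> ds i x = 0
        & exists (a : L) (alpha delta : 'End(L)),
          [/\ a \in Gs i,
              (alpha @: Is i <= Is i)%VS /\
                (forall x, x \in Gs i -> alpha x = 0),
              (delta @: Gs i <= Is i)%VS /\
                (forall x, x \in Is i -> delta x = 0),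
              (forall x, x \in Ls i -> ds i x = br x a + alpha x + delta x)
            & (forall x y, x \in Ls i -> y \in Ls i ->
                 alpha (br x y) = br (alpha x) y) /\
              ((forall x, x \in Ls i -> alpha x = 0) \/
               (alpha @: Is i)%VS = Is i)]].
Proof.
have cap0 i : (Ls i :&: \sum_(j < s | j != i) Ls j = 0)%VS.
  by apply: (directv_sumP Ls_direct).
pose W i := (\sum_(j < s | j != i) Ls j)%VS.
(* The projections p_i sum to the identity, so d is the sum of the d p_i, and d p_i agrees with d on
   the i-th summand. *)
pose p i := daddv_pi (Ls i) (W i).
have pid i x : x \in Ls i -> p i x = x by apply: daddv_pi_id.
have p0 i j x : j != i -> x \in Ls j -> p i x = 0.
  move=> ji xj; have xW : x \in W i by apply: (subvP (sumv_sup j _ _)) xj.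
  have := @daddv_pi_add _ _ (Ls i) (W i) x (cap0 i).
  rewrite -[X in X \in _]add0r memv_add ?mem0v // => /(_ isT).
  rewrite [X in _ + X = _]daddv_pi_id // 1?capvC //.
  by move/(canRL (addrK _)); rewrite subrr.
exists (fun i => d \o p i)%VF; split.
  apply/lfunP => x; have : x \in (\sum_(i < s) Ls i)%VS by rewrite Ls_sum memvf.
  case/memv_sumP=> xs xsL ->; rewrite sum_lfunE linear_sum.
  apply: eq_bigr => i _.
  rewrite comp_lfunE linear_sum (bigD1 i) //= pid ?xsL // big1 ?addr0 //.
  move=> j ji.
  by rewrite (p0 i j) ?xsL.
move=> i.
have dpE x : x \in Ls i -> (d \o p i)%VF x = d x.
  by move=> xi; rewrite comp_lfunE pid.
split.
- split=> [|x y xi yi].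
    apply/subvP => _ /memv_imgP[x xi ->]; rewrite dpE //.
    exact: (derivation_stable (Ls_ideal i) (Ls_simple i) (Is_squares i) d_der).
  rewrite !dpE ?(derivationE d_der) //.
  exact: (ideal_brl (Ls_ideal i)).
- by move=> j x ji xj; rewrite comp_lfunE (p0 i j) ?linear0.
have [a [al [de [aG alP deP dE alE]]]] :=
  simple_leibniz_derivation leibL (Ls_ideal i) (Ls_simple i) (Is_squares i)
    d_der (Gs_lie i) (GsIs_direct i) (GsIs_sum i) charF0.
by exists a, al, de; split=> // x xi; rewrite dpE // dE.
Qed.
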